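(* For every integer $t\ge 1$, the profile complexity of the class of $K_t$-minor-free graphs is in $O_t(r^{t^2-1})$. That is, for every integer $t\ge 1$ the class of $K_t$-minor-free graphs has a profile complexity function $f_t:\mathbb{N}\to\mathbb{N}$, and there is a constant $C_t$ depending only on $t$ such that $f_t(r)\le C_t\, r^{t^2-1}$ for every integer $r\ge 1$.
   Context: All graphs are finite, simple and undirected. For a graph $G$, a set $A\subseteq V(G)$, a vertex $u$ and an integer $r\ge 0$, the profile of $u$ on $A$ at distance $r$ is the function $A\to\{0,\dots,r,+\infty\}$ mapping each $a\in A$ to $\mathrm{dist}_G(u,a)$ if $\mathrm{dist}_G(u,a)\le r$, and to $+\infty$ otherwise. The profile complexity of a class $\mathcal{C}$ of graphs is the minimum function $f:\mathbb{N}\to\mathbb{N}$ (if it exists) such that for every $G\in\mathcal{C}$, every nonempty set $A\subseteq V(G)$ and every nonnegative integer $r$, the number of distinct profiles on $A$ at distance $r$ (over all vertices $u\in V(G)$) is at most $f(r)\,|A|$. *)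

(* Defs.v *)
(* MathComp world. *)
From mathcomp Require Import all_boot.

Set Implicit Arguments.
Unset Strict Implicit.
Unset Printing Implicit Defensive.

Record sgraph := SGraph {
  vertex :> finType;
  adj : rel vertex;
  adj_sym : symmetric adj;
  adj_irrefl : irreflexive adj
}.

Section Distance.
Variable G : sgraph.
Implicit Types u v : G.

(* The vertices after u are listed in p; n is the number of edges. *)
Definition has_path u v (n : nat) : bool :=
  [exists p : n.-tuple G, [&& path (@adj G) u p, uniq (u :: p) & last u p == v]].

Lemma connect_has_path u v : connect (@adj G) u v -> exists n, has_path u v n.
Proof.
case/connectP=> p /shortenP[q pq uq _] ->.
exists (size q); apply/existsP; exists (in_tuple q).
by rewrite pq uq eqxx.
Qed.

(* None stands for an infinite distance. *)
Definition dist u v : option nat :=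
  match @idP (connect (@adj G) u v) with
  | ReflectT uv => Some (ex_minn (connect_has_path uv))
  | ReflectF _ => None
  end.

End Distance.

Section Profiles.
Variables (G : sgraph) (A : {set G}) (r : nat).

(* None stands for +oo; insub d is Some d if d < r.+1 and None otherwise. *)
Definition profile (u : G) : {ffun {a : G | a \in A} -> option 'I_r.+1} :=
  [ffun a => obind insub (dist u (val a))].

Definition profiles : {set {ffun {a : G | a \in A} -> option 'I_r.+1}} :=
  [set profile u | u : G].

End Profiles.

Definition graph_class := sgraph -> Prop.

Definition bounds_profiles (C : graph_class) (f : nat -> nat) : Prop :=
  forall G : sgraph, C G ->
  forall A : {set G}, A != set0 ->
  forall r : nat, #|profiles A r| <= f r * #|A|.

(* "Minimum" is with respect to the pointwise order on functions. *)
Definition is_profile_complexity (C : graph_class) (f : nat -> nat) : Prop :=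
  bounds_profiles C f /\
  forall g : nat -> nat, bounds_profiles C g -> forall r, f r <= g r.

Definition connected_set (G : sgraph) (S : {set G}) : Prop :=
  S != set0 /\
  {in S &, forall x y,
    connect [rel a b | [&& a \in S, b \in S & adj a b]] x y}.

(* H is a minor of G, expressed by branch sets. *)
Definition minor (H G : sgraph) : Prop :=
  exists B : H -> {set G},
    [/\ forall x, connected_set (B x),
        forall x y, x != y -> [disjoint B x & B y] &
        forall x y, adj x y ->
          exists a b, [/\ a \in B x, b \in B y & adj a b]].

Lemma complete_sym t : symmetric [rel x y : 'I_t | x != y].
Proof. by move=> x y; rewrite /= eq_sym. Qed.

Lemma complete_irrefl t : irreflexive [rel x y : 'I_t | x != y].
Proof. by move=> x; rewrite /= eqxx. Qed.

Definition complete_graph (t : nat) : sgraph :=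
  SGraph (@complete_sym t) (@complete_irrefl t).

Definition Kt_minor_free (t : nat) : graph_class :=
  fun G => ~ minor (complete_graph t) G.

(* Main.v *)
Require Import Defs.
From Stdlib Require Import ClassicalEpsilon.
From mathcomp Require Import all_boot zify.

Set Implicit Arguments.
Unset Strict Implicit.
Unset Printing Implicit Defensive.

(** Write t = k + 2; the case t = 1 is void, since a K_1-minor-free graph has
    no vertex.  Two properties of a K_t-minor-free graph G are combined.

    First, G has few traces.  For a set X of vertices, the trace of u records
    the pairs (x, i) with x in X, i <= r and dist(u, x) <= i.  If the traces
    shattered t pairs (a_j, i_j), the Voronoi cells of the points a_j for the
    shifted distances dist(x, a_j) - i_j would be connected, disjoint and
    pairwise adjacent, that is, a K_t minor ([shattered_trace_minor]).  The
    Sauer-Shelah bound then allows at most (|X| (r + 1) + 1)^(t - 1) traces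
    ([card_traces]).

    Second, G has small weak reachability sets.  The vertex set splits into
    successive connected pieces such that each component of what remains
    touches at most k earlier pieces, and these touch each other: more would
    give a K_t minor ([card_touching]).  A new piece is chosen inside such a
    component as a union of at most k geodesics from one vertex, so that it
    meets a ball of radius n in O(n) vertices ([decomposition]).  Let l x be
    the rank of the piece of x.  The weak reachability set [wreach l n u]
    consists of the x joined to u by a walk of length at most n on which l is
    at least l x.  Such a walk visits pieces along an acyclic relation whose
    out-neighbourhoods are cliques of size at most k, and in such a relation
    n steps reach at most (n + 1)^k points ([card_reach]).  Hence the set has
    O(n^(k + 1)) vertices ([card_wreach]).

    These combine as follows.  Let A' be the union of the sets [wreach l r a]
    for a in A.  A path of length at most r from u to a meets, at its vertex
    of least rank, both [wreach l r u] and [wreach l r a].  So the profile of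
    u on A is determined by the distances from u to the vertices of
    [wreach l r u :&: A'], and this set lies in [wreach l (2 r) v], where v is
    its vertex of largest rank.  Thus the number of profiles is at most |A'|
    times the number of traces on a set [wreach l (2 r) v], which is
    O(r^(k + 1)) |A| times O((r r^(k + 1))^(k + 1)); the exponents add up to
    (k + 1) (k + 3) = t^2 - 1 ([card_profiles]). *)

(** * Bounded walks *)

Section Within.
Variables (T : finType) (e : rel T).

Fixpoint within (n : nat) (x y : T) : bool :=
  (x == y) || (if n is m.+1 then [exists z, e x z && within m z y] else false).

Lemma within_refl n x : within n x x.
Proof. by case: n => [|n] /=; rewrite eqxx. Qed.

Lemma withinS n x z y : e x z -> within n z y -> within n.+1 x y.
Proof.
move=> xz zy /=; apply/orP; right; apply/existsP; exists z.
by rewrite xz.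
Qed.

Lemma withinSE n x y :
  within n.+1 x y -> x = y \/ exists2 z, e x z & within n z y.
Proof.
move=> /= /orP[/eqP->|/existsP[z /andP[xz zy]]]; first by left.
by right; exists z.
Qed.

Lemma within0 x y : within 0 x y = (x == y).
Proof. by rewrite /= orbF. Qed.

Lemma within_mono m n x y : m <= n -> within m x y -> within n x y.
Proof.
elim: m n x => [|m IH] [|n] x //; first by rewrite within0 => _ /eqP->; exact: within_refl.
move=> mn /withinSE[->|[z xz zy]]; first exact: within_refl.
exact: withinS xz (IH _ _ mn zy).
Qed.

Lemma within_trans m n x y z : within m x y -> within n y z -> within (m + n) x z.
Proof.
elim: m x => [|m IH] x; first by rewrite within0 => /eqP->.
move=> /withinSE[->|[w xw wy]] yz; first exact: within_mono (leq_addl _ _) yz.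
exact: withinS xw (IH _ wy yz).
Qed.

Lemma within1 x y : e x y -> within 1 x y.
Proof. by move=> xy; apply: withinS xy (within_refl 0 y). Qed.

Lemma within_sym n x y : symmetric e -> within n x y -> within n y x.
Proof.
move=> eC; elim: n x => [|n IH] x; first by rewrite !within0 eq_sym.
move=> /withinSE[->|[z xz zy]]; first exact: within_refl.
rewrite -addn1; apply: within_trans (IH _ zy) _.
by apply: within1; rewrite eC.
Qed.

Lemma within_connect n x y : within n x y -> connect e x y.
Proof.
elim: n x => [|n IH] x; first by rewrite within0 => /eqP->.
by move=> /withinSE[->|[z xz /IH zy]] //; apply: connect_trans (connect1 xz) zy.
Qed.

Lemma within_path x p : path e x p -> within (size p) x (last x p).
Proof.
elim: p x => [|z p IH] x /=; first by rewrite eqxx.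
by case/andP=> xz /IH zp; apply: withinS xz zp.
Qed.

Lemma within_uniq_path n x y : within n x y ->
  exists2 p, [&& path e x p, uniq (x :: p) & last x p == y] & size p <= n.
Proof.
move=> xy; have [p px [<- pn]] : exists2 p, path e x p & last x p = y /\ size p <= n.
  elim: n x xy => [|n IH] x; first by rewrite within0 => /eqP->; exists [::].
  case/withinSE=> [->|[z xz /IH[p zp [<- pn]]]]; first by exists [::].
  by exists (z :: p); rewrite /= ?xz.
case/shortenP: px => q xq uq qp; exists q; first by rewrite xq uq eqxx.
by apply: leq_trans (uniq_leq_size _ qp) pn; case/andP: uq.
Qed.

Lemma connect_within x y : connect e x y -> exists2 n, n < #|T| & within n x y.
Proof.
case/connectP=> p /shortenP[q pq uq _] ->; exists (size q); last exact: within_path.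
by have := max_card [in x :: q]; rewrite (card_uniqP uq).
Qed.

Definition gdist (x y : T) : nat := find (fun n => within n x y) (iota 0 #|T|).

(** For joined points, [within] and [gdist] carry the same information; all
    facts about [gdist] come from facts about walks through this equation. *)
Lemma within_gdist n x y : connect e x y -> within n x y = (gdist x y <= n).
Proof.
move=> /connect_within[m mT xy].
have hs : has (fun n => within n x y) (iota 0 #|T|).
  by apply/hasP; exists m; rewrite // mem_iota.
have lt : gdist x y < #|T| by rewrite -[X in _ < X](size_iota 0) -has_find.
apply/idP/idP => [xny|]; last first.
  move=> le; apply: within_mono le _.
  by have := nth_find 0 hs; rewrite -/(gdist x y) nth_iota.
rewrite leqNgt; apply/negP => ltn.
have := @before_find _ 0 (fun n => within n x y) (iota 0 #|T|) n ltn.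
by rewrite nth_iota ?add0n ?xny //; apply: ltn_trans lt.
Qed.

Lemma gdist_within x y : connect e x y -> within (gdist x y) x y.
Proof. by move=> xy; rewrite within_gdist. Qed.

Lemma gdist_step x z y : e x z -> connect e z y -> gdist x y <= (gdist z y).+1.
Proof.
move=> xz zy; have xy := connect_trans (connect1 xz) zy.
by rewrite -within_gdist //; apply: withinS xz (gdist_within zy).
Qed.

(** The first step of a shortest walk. *)
Lemma gdist_descent x y : connect e x y -> x != y ->
  exists z, [/\ e x z, connect e z y & gdist x y = (gdist z y).+1].
Proof.
move=> xy nxy; have := gdist_within xy.
case E: (gdist x y) => [|n]; first by rewrite within0 (negPf nxy).
case/withinSE => [xE|[z xz zy]]; first by rewrite xE eqxx in nxy.
have cz := within_connect zy; exists z; split=> //.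
apply/anti_leq; rewrite -E gdist_step //= E ltnS -within_gdist //.
Qed.

End Within.

Lemma within_subrel (T : finType) (e e' : rel T) n x y :
  subrel e e' -> within e n x y -> within e' n x y.
Proof.
move=> ee; elim: n x => [|n IH] x //.
move=> /withinSE[->|[z xz zy]]; first exact: within_refl.
exact: withinS (ee _ _ xz) (IH _ zy).
Qed.

(** On [D], the value of [f] is a function of the value of [g]. *)
Lemma leq_imset_factor (T U V : finType) (D : {set T}) (f : T -> U) (g : T -> V) :
  {in D &, forall x y, g x = g y -> f x = f y} -> #|f @: D| <= #|g @: D|.
Proof.
move=> fg.
pose h (w : V) := omap f [pick x in D | g x == w].
rewrite -(card_imset _ Some_inj); apply: (@leq_trans #|h @: (g @: D)|); last exact: leq_imset_card.
apply/subset_leq_card/subsetP=> _ /imsetP[_ /imsetP[x xD ->] ->].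
apply/imsetP; exists (g x); first exact: imset_f.
rewrite /h; case: pickP => [y /andP[yD /eqP yx]|/(_ x)] /=; last by rewrite xD eqxx.
by congr Some; apply: fg.
Qed.

(** * The Sauer-Shelah bound *)

Section Shattering.
Variable T : finType.
Implicit Types (F : {set {set T}}) (S U X : {set T}).

Definition shatters F S :=
  [forall U : {set T}, (U \subset S) ==> [exists X in F, X :&: S == U]].

Lemma shattersP F S :
  reflect (forall U, U \subset S -> exists2 X, X \in F & X :&: S = U) (shatters F S).
Proof.
apply: (iffP forallP) => [sh U US|sh U].
  by have /implyP/(_ US)/existsP[X /andP[XF /eqP XU]] := sh U; exists X.
by apply/implyP=> /sh[X XF XU]; apply/existsP; exists X; rewrite XF XU /=.
Qed.

Lemma shatters_sub F F' S : F \subset F' -> shatters F S -> shatters F' S.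
Proof.
move=> /subsetP FF /shattersP sh; apply/shattersP=> U /sh[X /FF XF XU].
by exists X.
Qed.

(** Pajor's form of the Sauer-Shelah lemma.  Choose x that separates two
    members of F, and let F1 and F0 be the members with and without x.  A set
    shattered by F1 or by F0 avoids x and is shattered by F; a set S shattered
    by both gives one more, x |: S.  So the shattered sets of F1 and F0,
    counted with multiplicity, inject into those of F, and induction
    applies. *)
Lemma pajor F : #|F| <= #|[set S | shatters F S]|.
Proof.
have [n] := ubnP #|F|; elim: n F => // n IH F ltF.
have [small|/card_gt1P[X [Y [XF YF XY]]]] := leqP #|F| 1.
  have [->|[X XF]] := set_0Vmem F; first by rewrite cards0.
  apply: leq_trans small _; rewrite card_gt0; apply/set0Pn; exists set0.
  rewrite inE; apply/shattersP=> U; rewrite subset0 => /eqP->.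
  by exists X; rewrite ?setI0.
have [x xXY] : exists x, (x \in X) != (x \in Y).
  apply/existsP; apply: contra_neqT XY; rewrite negb_exists => /forallP XY.
  by apply/setP=> x; apply/eqP; have := XY x; rewrite negbK.
pose F1 := [set Z in F | x \in Z]; pose F0 := [set Z in F | x \notin Z].
have cF : #|F| = #|F1| + #|F0|.
  rewrite -(cardsID [set Z : {set T} | x \in Z] F); congr (_ + _); apply: eq_card => Z.
    by rewrite !inE.
  by rewrite !inE andbC.
have [F1p F0p] : 0 < #|F1| /\ 0 < #|F0|.
  move: xXY; rewrite !card_gt0; case: (boolP (x \in X)) => xX; case: (boolP (x \in Y)) => xY //= _.
    by split; apply/set0Pn; [exists X | exists Y]; rewrite inE ?XF ?YF.
  by split; apply/set0Pn; [exists Y | exists X]; rewrite inE ?XF ?YF.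
have sub1 : F1 \subset F by apply/subsetP=> Z; rewrite inE => /andP[].
have sub0 : F0 \subset F by apply/subsetP=> Z; rewrite inE => /andP[].
have IH1 : #|F1| <= #|[set S | shatters F1 S]| by apply: IH; lia.
have IH0 : #|F0| <= #|[set S | shatters F0 S]| by apply: IH; lia.
set S1 := [set S | shatters F1 S] in IH1; set S0 := [set S | shatters F0 S] in IH0.
have x1 S : S \in S1 -> x \notin S.
  rewrite inE => /shattersP/(_ set0 (sub0set _))[Z]; rewrite inE => /andP[_ xZ] Z0.
  by apply/negP=> xS; have := in_set0 x; rewrite -Z0 inE xZ xS.
have x0 S : S \in S0 -> x \notin S.
  rewrite inE => /shattersP/(_ S (subxx _))[Z]; rewrite inE => /andP[_ xZ] ZS.
  by apply: contra xZ; rewrite -{1}ZS inE => /andP[].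
pose J := [set x |: S | S in S1 :&: S0].
have cJ : #|J| = #|S1 :&: S0|.
  apply: card_in_imset => S S' /setIP[/x1 xS _] /setIP[/x1 xS' _] eqS.
  by rewrite -(setU1K xS) -(setU1K xS') eqS.
have dJ : [disjoint S1 :|: S0 & J].
  apply/pred0P=> S /=; apply/negbTE/negP=> /andP[SS /imsetP[S' _ SE]].
  have : x \notin S by case/setUP: SS => [/x1|/x0].
  by rewrite SE setU11.
rewrite cF; apply: (@leq_trans #|(S1 :|: S0) :|: J|).
  move: (cardsU (S1 :|: S0) J); rewrite disjoint_setI0 // cards0 cJ.
  by have := cardsUI S1 S0; lia.
apply/subset_leq_card/subsetP=> S /setUP[/setUP[]|/imsetP[S' /setIP[SS1 SS0] ->]].
- by rewrite !inE; apply: shatters_sub.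
- by rewrite !inE; apply: shatters_sub.
rewrite inE; apply/shattersP=> U US; have xS' := x1 _ SS1.
have US' : U :\ x \subset S' by rewrite subDset.
move: SS1 SS0; rewrite !inE => /shattersP/(_ _ US')[Z1 Z1F Z1U] /shattersP/(_ _ US')[Z0 Z0F Z0U].
have [xU|xU] := boolP (x \in U).
  exists Z1; first exact: (subsetP sub1).
  have xZ1 : x \in Z1 by move: Z1F; rewrite inE => /andP[].
  by rewrite setIUr Z1U (setIidPr _) ?sub1set // setD1K.
exists Z0; first exact: (subsetP sub0).
have xZ0 : x \notin Z0 by move: Z0F; rewrite inE => /andP[].
rewrite setIUr Z0U; apply/setP=> y; rewrite !inE.
by have [->|] := eqVneq y x; rewrite ?(negPf xZ0) ?(negPf xU) ?andbF.
Qed.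

(** A set of at most d elements of X is listed, with padding by [None], by a
    d-tuple in [option X]. *)
Lemma card_small_subsets X d : #|[set S : {set T} | S \subset X & #|S| <= d]| <= #|X|.+1 ^ d.
Proof.
pose R := [set o : option T | if o is Some x then x \in X else true].
have cR : #|R| = #|X|.+1.
  have -> : R = None |: (Some @: X).
    apply/setP=> -[x|]; rewrite !inE //=.
    by rewrite (mem_imset _ _ Some_inj).
  by rewrite cardsU1 card_imset ?(introF imsetP) //; [case | apply: Some_inj].
pose h (f : {ffun 'I_d -> option T}) := [set x | Some x \in codom f].
rewrite -cR -[X in _ <= _ ^ X]card_ord -card_ffun_on.
rewrite -(cardsE (ffun_on R)); apply: leq_trans (leq_imset_card h _).
apply/subset_leq_card/subsetP=> S; rewrite inE => /andP[SX Sd].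
pose f := [ffun i : 'I_d => nth None (map Some (enum S)) i].
apply/imsetP; exists f.
  rewrite inE; apply/ffun_onP=> i; rewrite ffunE inE.
  case E: (nth _ _ _) => [x|] //.
  have [lti|] := ltnP i (size (map Some (enum S))); last by move=> /(nth_default None) N; rewrite N in E.
  have := mem_nth None lti; rewrite E (mem_map Some_inj) mem_enum.
  exact: (subsetP SX).
apply/setP=> x; rewrite inE; apply/idP/codomP => [xS|[i]].
  have xs : x \in enum S by rewrite mem_enum.
  have lti : index x (enum S) < size (enum S) by rewrite index_mem.
  have ltd : index x (enum S) < d by apply: leq_trans Sd; rewrite cardE.
  exists (Ordinal ltd); rewrite ffunE /= (nth_map x) // nth_index //.
rewrite ffunE => E.
have [lti|] := ltnP i (size (map Some (enum S))); last by move=> /(nth_default None) N; rewrite N in E.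
by have := mem_nth None lti; rewrite -E (mem_map Some_inj) mem_enum.
Qed.

Lemma sauer_shelah F X d :
  (forall Y, Y \in F -> Y \subset X) -> (forall S, shatters F S -> #|S| <= d) ->
  #|F| <= #|X|.+1 ^ d.
Proof.
move=> FX Fd; apply: leq_trans (pajor F) (leq_trans _ (card_small_subsets X d)).
apply/subset_leq_card/subsetP=> S; rewrite !inE => sh; rewrite Fd // andbT.
have /shattersP/(_ S (subxx _))[Y YF <-] := sh.
by apply: subset_trans (subsetIl _ _) (FX _ YF).
Qed.

End Shattering.

(** * Traces and Voronoi cells *)

Section Graph.
Variable G : sgraph.
Implicit Types (S C : {set G}) (x y z u v : G).

Definition induced S : rel G := [rel a b | [&& a \in S, b \in S & adj a b]].

Definition touch S S' := exists a b, [/\ a \in S, b \in S' & adj a b].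

Lemma induced_sym S : symmetric (induced S).
Proof. by move=> x y; rewrite /induced /= adj_sym andbCA. Qed.

Lemma adj_connect_sym : connect_sym (@adj G).
Proof. exact: sym_connect_sym (@adj_sym G). Qed.

Lemma induced_connect_sym S : connect_sym (induced S).
Proof. exact: sym_connect_sym (induced_sym S). Qed.

Lemma induced_sub S S' : S \subset S' -> subrel (induced S) (induced S').
Proof.
by move=> /subsetP SS x y /and3P[xS yS xy]; rewrite /induced /= !SS.
Qed.

Lemma induced_adj S : subrel (induced S) (@adj G).
Proof. by move=> x y /and3P[]. Qed.

Lemma connect_induced_sub S S' x y :
  S \subset S' -> connect (induced S) x y -> connect (induced S') x y.
Proof.
by move=> SS; apply: connect_sub => a b ab; apply/connect1/induced_sub/ab.
Qed.

Lemma connect_induced_mem S x y : x \in S -> connect (induced S) x y -> y \in S.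
Proof.
move=> xS; rewrite induced_connect_sym => /connectP[[|z p] /=]; first by move=> _ <-.
by case/andP=> /and3P[].
Qed.

Lemma connected_center S c : c \in S ->
  (forall x, x \in S -> connect (induced S) c x) -> connected_set S.
Proof.
move=> cS cc; split; first by apply/set0Pn; exists c.
move=> x y xS yS; apply: connect_trans (cc y yS).
by rewrite induced_connect_sym; apply: cc.
Qed.

Lemma touch_sym S S' : touch S S' -> touch S' S.
Proof. by case=> a [b [aS bS ab]]; exists b, a; rewrite adj_sym. Qed.

(** Branch sets may be indexed by any finite set with at least t elements. *)
Lemma complete_minor (I : finType) (P : {set I}) (B : I -> {set G}) t :
  t <= #|P| ->
  {in P, forall i, connected_set (B i)} ->
  {in P &, forall i j, i != j -> [disjoint B i & B j] /\ touch (B i) (B j)} ->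
  minor (complete_graph t) G.
Proof.
move=> tP Bc Bd.
pose f (i : complete_graph t) : I := enum_val (widen_ord tP i).
have fP i : f i \in P by apply: enum_valP.
have fI i j : i != j -> f i != f j.
  by apply: contraNneq => /enum_val_inj/(congr1 val) /= ij; apply/eqP/val_inj.
exists (fun i => B (f i)); split=> [i|i j ij|i j ij]; first exact: Bc.
  by case: (Bd _ _ (fP i) (fP j) (fI _ _ ij)).
by case: (Bd _ _ (fP i) (fP j) (fI _ _ ij)).
Qed.

Section Voronoi.
Variables (r : nat) (S : {set G * 'I_r.+1}).
Let I := (G * 'I_r.+1)%type.
Implicit Types p q m : I.

(** The site p = (a, i) of the diagram attracts x with the shifted distance
    dist(x, a) - i; adding r keeps it in [nat]. *)
Definition weight p x := gdist (@adj G) x p.1 + (r - p.2).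

(** The weight and the rank of p are the two digits of a number in base
    [#|{: I}|]: comparing keys compares weights, and breaks ties by a rule that
    is the same at all vertices. *)
Definition rkey p x := weight p x * #|{: I}| + enum_rank p.

(** The guard on [q] discards the sites that lie in another component of G,
    for which [gdist] has no meaning. *)
Definition cell p : {set G} :=
  [set x | connect (@adj G) x p.1 &
    [forall q in S, connect (@adj G) x q.1 ==> (rkey p x <= rkey q x)]].

Lemma cellP p x : reflect
  (connect (@adj G) x p.1 /\
   forall q, q \in S -> connect (@adj G) x q.1 -> rkey p x <= rkey q x) (x \in cell p).
Proof.
rewrite inE; apply: (iffP andP) => -[cx H]; split=> //.
  by move=> q qS cq; have /forallP/(_ q) := H; rewrite qS cq.
by apply/forallP=> q; apply/implyP=> qS; apply/implyP=> cq; apply: H.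
Qed.

Lemma rkey_inj p q x : rkey p x = rkey q x -> p = q.
Proof.
move=> /(congr1 (modn^~ #|{: I}|)); rewrite /rkey !modnMDl !modn_small //.
by move=> /val_inj/enum_rank_inj.
Qed.

Lemma rkey_lt p q x : weight p x < weight q x -> rkey p x < rkey q x.
Proof.
move=> lt; have : enum_rank p < #|{: I}| by exact: ltn_ord.
by have := leq_mul lt (leqnn #|{: I}|); rewrite /rkey mulSn; lia.
Qed.

Lemma rkey_step p x y : adj x y -> connect (@adj G) y p.1 ->
  rkey p x <= rkey p y + #|{: I}|.
Proof.
move=> xy yp; have := gdist_step xy yp; rewrite /rkey /weight; nia.
Qed.

Lemma rkey_descent p x y : gdist (@adj G) x p.1 = (gdist (@adj G) y p.1).+1 ->
  rkey p x = rkey p y + #|{: I}|.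
Proof. by rewrite /rkey /weight => ->; nia. Qed.

Lemma cell_disjoint p q : p \in S -> q \in S -> p != q -> [disjoint cell p & cell q].
Proof.
move=> pS qS pq; apply/pred0P=> x /=; apply/negbTE/negP=> /andP[].
move=> /cellP[cp Hp] /cellP[cq Hq]; move/eqP: pq; apply.
by apply: (@rkey_inj _ _ x); apply/anti_leq; rewrite Hp ?Hq.
Qed.

(** Cells are star-shaped: along an edge towards p the key of p drops by a full
    unit of weight, and no other key can drop by more. *)
Lemma cell_closed p x y : p \in S -> x \in cell p -> adj x y ->
  gdist (@adj G) x p.1 = (gdist (@adj G) y p.1).+1 -> y \in cell p.
Proof.
move=> pS /cellP[cp Hp] xy xyE; apply/cellP.
have yx : connect (@adj G) y x by rewrite adj_connect_sym connect1.
split=> [|q qS cq]; first exact: connect_trans yx cp.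
have := Hp _ qS (connect_trans (connect1 xy) cq).
have := rkey_step xy cq; rewrite (rkey_descent xyE).
by move=> a b; rewrite -(leq_add2r #|{: I}|); apply: leq_trans b a.
Qed.

Lemma cell_connected p : p \in S -> p.1 \in cell p -> connected_set (cell p).
Proof.
move=> pS pc; apply: (connected_center pc) => x xc.
have [n] := ubnP (gdist (@adj G) x p.1); elim: n x xc => // n IH x xc lt.
have [->|nx] := eqVneq x p.1; first exact: connect0.
have /cellP[cp _] := xc.
have [y [xy yp E]] := gdist_descent cp nx.
have yc := cell_closed pS xc xy E.
apply: connect_trans (IH _ yc _) (connect1 _); first by rewrite E in lt.
by rewrite /induced /= yc xc adj_sym.
Qed.

(** From a vertex of [cell p] that is nearer to [q] than to any third site,
    a shortest path to [q] runs through [cell p] and then [cell q]. *)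
Lemma cell_touch p q x : p \in S -> q \in S -> p != q ->
  q.1 \in cell q -> x \in cell p -> connect (@adj G) x q.1 ->
  (forall m, m \in S -> m != p -> m != q -> connect (@adj G) x m.1 ->
     rkey q x < rkey m x) ->
  touch (cell p) (cell q).
Proof.
move=> pS qS pq qc.
have [n] := ubnP (gdist (@adj G) x q.1); elim: n x => // n IH x lt xp cq far.
have nx : x != q.1.
  by apply/eqP=> xq; have /pred0P/(_ x)/= := cell_disjoint pS qS pq; rewrite xp xq qc.
have [y [xy yq E]] := gdist_descent cq nx.
have yx : connect (@adj G) y x by rewrite adj_connect_sym connect1.
have fary m : m \in S -> m != p -> m != q -> connect (@adj G) y m.1 ->
     rkey q y < rkey m y.
  move=> mS mp mq ym.
  have := far m mS mp mq (connect_trans (connect1 xy) ym).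
  have := rkey_step xy ym; rewrite (rkey_descent E).
  by move=> a b; rewrite -(ltn_add2r #|{: I}|); apply: leq_trans b a.
have /cellP[xcp _] := xp.
have ycp := connect_trans yx xcp.
have [pley|qlty] := leqP (rkey p y) (rkey q y).
  apply: (IH y) => //; first by rewrite E in lt.
  apply/cellP; split=> // m mS ym.
  have [->//|mp] := eqVneq m p; have [->//|mq] := eqVneq m q.
  exact: leq_trans pley (ltnW (fary _ mS mp mq ym)).
exists x, y; split=> //; apply/cellP; split=> // m mS ym.
have [->|mp] := eqVneq m p; first exact: ltnW.
have [->//|mq] := eqVneq m q.
exact: ltnW (fary _ mS mp mq ym).
Qed.

End Voronoi.

Definition trace (X : {set G}) r u : {set G * 'I_r.+1} :=
  [set p : G * 'I_r.+1 | (p.1 \in X) && within (@adj G) p.2 u p.1].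

(** Realising the singletons of S puts every site in its own cell, so cells are
    connected.  A vertex u whose trace meets S in exactly {p, q} is nearer to p
    and q than to any other site; it lies in one of the two cells, and
    [cell_touch] finds an edge to the other. *)
Lemma shattered_trace_minor X r t (S : {set G * 'I_r.+1}) :
  shatters [set trace X r u | u : G] S -> t <= #|S| -> minor (complete_graph t) G.
Proof.
move=> /shattersP sh tS.
have shE (U : {set G * 'I_r.+1}) : U \subset S -> exists u, forall p : G * 'I_r.+1, p \in S ->
    (p \in U) = within (@adj G) p.2 u p.1.
  move=> US; have [X0 X0F X0U] := sh U US; have /imsetP[u _ uE] := X0F; exists u => p pS.
  have pX : p.1 \in X.
    have [Y /imsetP[w _ ->] wS] := sh S (subxx _).
    by move: pS; rewrite -wS !inE => /andP[/andP[]].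
  by rewrite -X0U uE !inE pS pX andbT.
have ler (p : G * 'I_r.+1) : p.2 <= r by rewrite -ltnS.
have pc (p : G * 'I_r.+1) : p \in S -> p.1 \in cell S p.
  move=> pS; apply/cellP; split=> // q qS cq.
  have [->//|qp] := eqVneq q p.
  have [u uE] := shE [set p] (etrans (sub1set _ _) pS).
  have := uE _ pS; rewrite set11 => /esym wp.
  have := uE _ qS; rewrite in_set1 (negPf qp) => /esym wq.
  have cup := within_connect wp; have cuq := connect_trans cup cq.
  apply/ltnW/rkey_lt; rewrite /weight.
  have -> : gdist (@adj G) p.1 p.1 = 0 by apply/eqP; rewrite -leqn0 -within_gdist // within_refl.
  have dq : q.2 < gdist (@adj G) u q.1 by rewrite ltnNge -within_gdist // wq.
  have : gdist (@adj G) u q.1 <= p.2 + gdist (@adj G) p.1 q.1.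
    by rewrite -within_gdist //; apply: within_trans wp (gdist_within cq).
  by have := ler p; have := ler q; lia.
apply: (complete_minor tS (B := cell S)) => [p pS|p q pS qS pq].
  exact: cell_connected (pc _ pS).
split; first exact: cell_disjoint.
have pqS : [set p; q] \subset S by rewrite subUset !sub1set pS.
have [u uE] := shE _ pqS.
have := uE _ pS; rewrite set21 => /esym wp.
have := uE _ qS; rewrite set22 => /esym wq.
have [cp cq] := (within_connect wp, within_connect wq).
have near (m : G * 'I_r.+1) : within (@adj G) m.2 u m.1 -> weight m u <= r.
  move=> wm; move: (wm); rewrite (within_gdist _ (within_connect wm)) /weight.
  by have := ler m; lia.
have far (m : G * 'I_r.+1) : m \in S -> m != p -> m != q -> connect (@adj G) u m.1 -> r < weight m u.
  move=> mS mp mq cm; have := uE _ mS; rewrite !inE (negPf mp) (negPf mq) => /esym.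
  by rewrite within_gdist // /weight; lia.
have farp (m n : G * 'I_r.+1) : weight n u <= r -> m \in S -> m != p -> m != q -> connect (@adj G) u m.1 ->
    rkey n u < rkey m u.
  by move=> wn mS mp mq cm; apply/rkey_lt/(leq_ltn_trans wn)/far.
have [lepq|ltqp] := leqP (rkey p u) (rkey q u).
  apply: (@cell_touch r S p q u) => //; first exact: pc.
    apply/cellP; split=> // m mS cm; have [->//|mp] := eqVneq m p; have [->//|mq] := eqVneq m q.
    by apply/ltnW/farp => //; apply: near.
  by move=> m mS mp mq cm; apply: farp => //; apply: near.
apply/touch_sym/(@cell_touch r S q p u) => //; first by rewrite eq_sym.
- exact: pc.
- apply/cellP; split=> // m mS cm; have [->|mp] := eqVneq m p; first exact: ltnW.
  have [->//|mq] := eqVneq m q.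
  by apply/ltnW/farp => //; apply: near.
by move=> m mS mq mp cm; apply: farp => //; apply: near.
Qed.

Lemma card_traces X r d : Kt_minor_free d.+1 G ->
  #|[set trace X r u | u : G]| <= (#|X| * r.+1).+1 ^ d.
Proof.
move=> free.
have <- : #|setX X [set: 'I_r.+1]| = #|X| * r.+1 by rewrite cardsX cardsT card_ord.
apply: sauer_shelah => [_ /imsetP[u _ ->]|S sh].
  by apply/subsetP=> p; rewrite !inE => /andP[->].
by rewrite leqNgt; apply/negP=> /(shattered_trace_minor sh).
Qed.

End Graph.

(** * Reachability in a relation with clique out-neighbourhoods *)

Section Reach.
Variable N : nat.
Implicit Types (e : rel 'I_N) (a b m x y z : 'I_N).

(** By the clique property, all points visited after y by a walk that stays
    above a1 have a1 as an out-neighbour.  At the first step below a1 the walk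
    enters an out-neighbour of a1, so that a walk from a1 can take over without
    being longer. *)
Lemma within_split e a1 s y x :
  (forall j a b, e j a -> e j b -> a < b -> e b a) ->
  e y a1 -> within e s y x ->
  within [rel j b | [&& e j a1, e j b & a1 < b]] s y x \/ within e s a1 x.
Proof.
move=> clique; elim: s y => [|s IH] y ya1; first by rewrite !within0 => yx; left.
case/withinSE=> [->|[z yz zx]]; first by left; apply: within_refl.
case: (ltngtP z a1) => [za|az|/val_inj za].
- by right; apply: withinS zx; apply: clique yz ya1 za.
- have za1 : e z a1 by apply: clique ya1 yz az.
  case: (IH z za1 zx) => [zx'|ax]; last by right; apply: within_mono ax.
  by left; apply: withinS zx'; rewrite /= ya1 yz az.
by right; rewrite -za; apply: within_mono zx.
Qed.

(** The bound satisfies c(k + 1, r + 1) <= c(k, r + 1) + c(k + 1, r).  Let a1 be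
    the least out-neighbour of m.  A walk from m either stays above a1 among
    points that have a1 as an out-neighbour, where out-degrees drop by one once
    a1 is discarded, or its end is reached from a1 with at least one step fewer
    than from m, since m itself has no out-neighbour below a1. *)
Lemma card_reach k e r m :
  (forall j a, e j a -> a < j) ->
  (forall j a b, e j a -> e j b -> a < b -> e b a) ->
  (forall j, #|[set a | e j a]| <= k) ->
  #|[set x | within e r m x]| <= r.+1 ^ k.
Proof.
elim: k e r m => [|k IHk] e r m dec clique card_e.
  rewrite expn0 -(cards1 m); apply/subset_leq_card/subsetP=> x; rewrite !inE.
  case: r => [|r]; first by rewrite within0 eq_sym.
  case/withinSE => [->//|[z mz _]].
  by have := card_e m; rewrite leqn0 cards_eq0 => /eqP/setP/(_ z); rewrite !inE mz.
elim: r m => [|r IHr] m.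
  rewrite exp1n -(cards1 m); apply/subset_leq_card/subsetP=> x.
  by rewrite !inE within0 eq_sym.
case: (set_0Vmem [set a | e m a]) => [m0|[a0]].
  apply: (@leq_trans #|[set m]|); last by rewrite cards1 expn_gt0.
  apply/subset_leq_card/subsetP=> x; rewrite 2!inE.
  by case/withinSE => [->//|[z mz _]]; move/setP: m0 => /(_ z); rewrite !inE mz.
rewrite inE => ma0; have [a1 ma1 a1min] := arg_minnP (fun a : 'I_N => a : nat) ma0.
pose e' := [rel j b | [&& e j a1, e j b & a1 < b]].
have sub : [set x | within e r.+1 m x] \subset
    [set x | within e' r.+1 m x] :|: [set x | within e r a1 x].
  apply/subsetP=> x; rewrite in_setU !in_set.
  case/withinSE => [->|[z mz zx]]; first by rewrite within_refl.
  have := a1min _ mz; rewrite leq_eqVlt => /orP[/eqP/val_inj->|az]; first by rewrite zx orbT.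
  have za1 : e z a1 by apply: clique ma1 mz az.
  case: (within_split clique za1 zx) => [zx'|->]; last by rewrite orbT.
  by apply/orP; left; apply: withinS zx'; rewrite /= ma1 mz az.
apply: leq_trans (subset_leq_card sub) _; rewrite cardsU.
apply: leq_trans (leq_subr _ _) _.
have le1 : #|[set x | within e' r.+1 m x]| <= r.+2 ^ k.
  apply: IHk => [j a /and3P[_ /dec]//|j a b|j].
    move=> /and3P[ja1 ja aa] /and3P[_ jb ab] lt_ab.
    by rewrite /e' /= aa (clique _ _ _ ja jb lt_ab) (clique _ _ _ ja1 jb ab).
  case ja1: (e j a1); last first.
    by rewrite (_ : [set _ | _] = set0) ?cards0 //; apply/setP=> a; rewrite !inE /= ja1.
  rewrite -ltnS; apply: leq_trans (card_e j).
  rewrite (cardsD1 a1 [set a | e j a]) inE ja1 ltnS.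
  apply/subset_leq_card/subsetP=> a; rewrite !inE => /and3P[_ -> lt].
  by rewrite andbT -val_eqE neq_ltn lt orbT.
apply: leq_trans (leq_add le1 (IHr a1)) _.
have : r.+1 ^ k.+1 <= r.+1 * r.+2 ^ k by rewrite expnS leq_mul //; case: (k) => [|j]; rewrite ?expn0 ?leq_exp2r.
by rewrite [r.+2 ^ k.+1]expnS; lia.
Qed.

End Reach.

Lemma card_bigcup (I T : finType) (P : {set I}) (F : I -> {set T}) c :
  {in P, forall i, #|F i| <= c} -> #|\bigcup_(i in P) F i| <= #|P| * c.
Proof.
move=> Fc; rewrite -sum_nat_const.
elim/big_ind2: _ => [|A a B b Aa Bb|i /Fc//]; first by rewrite cards0.
by apply: leq_trans (leq_card_setU _ _) (leq_add Aa Bb).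
Qed.

(** * Decomposition into connected pieces *)

Section Decomposition.
Variable G : sgraph.
Implicit Types (U C : {set G}) (u v x y z : G) (l : G -> nat).

Definition component U v : {set G} := [set y | connect (induced U) v y].

Lemma component_sub U v : v \in U -> component U v \subset U.
Proof. by move=> vU; apply/subsetP=> y; rewrite inE; apply: connect_induced_mem. Qed.

Lemma component_connected U v : v \in U -> connected_set (component U v).
Proof.
move=> vU; have vC : v \in component U v by rewrite inE connect0.
apply: (connected_center vC) => x; rewrite inE => /connectP[p pp ->].
elim/last_ind: p pp => [|p y IH]; first by [].
rewrite rcons_path last_rcons => /andP[pp py].
apply: connect_trans (IH pp) (connect1 _).
have cp : connect (induced U) v (last v p) by apply/connectP; exists p.
rewrite /induced /= !inE cp (connect_trans cp (connect1 py)) /=.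
by case/and3P: py.
Qed.

(** The vertex set of a shortest path from v to y, described by what is needed of
    it: it is connected and contains at most one vertex at each distance from
    v. *)
Lemma geodesic U v y : v \in U -> y \in component U v ->
  exists P : {set G}, [/\ v \in P /\ y \in P, P \subset component U v,
    forall x, x \in P -> connect (induced P) v x &
    {in P &, injective (fun x => gdist (induced U) x v)}].
Proof.
move=> vU yC; pose f x := gdist (induced U) x v.
suff [P [vyP PC Pc Pi _]] : exists P : {set G}, [/\ v \in P /\ y \in P, P \subset component U v,
    forall x, x \in P -> connect (induced P) v x, {in P &, injective f} &
    forall x, x \in P -> f x <= f y] by exists P.
have [n] := ubnP (f y); elim: n y yC => // n IH y yC lt.
have cyv : connect (induced U) y v by rewrite inE induced_connect_sym in yC.
have [->|nyv] := eqVneq y v.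
  exists [set v]; split; rewrite ?set11 //.
  - by rewrite sub1set inE connect0.
  - by move=> x /set1P->; apply: connect0.
  - by move=> a b /set1P-> /set1P->.
  - by move=> x /set1P->.
have [z [yz zv E]] := gdist_descent cyv nyv.
have fE : f y = (f z).+1 := E.
have zC : z \in component U v by rewrite inE induced_connect_sym.
have [|P [[vP zP] PC Pc Pi Pf]] := IH z zC; first by rewrite fE in lt.
have PS : P \subset y |: P by apply: subsetUr.
exists (y |: P); split.
- by rewrite setU11 setU1r.
- by rewrite subUset sub1set yC PC.
- move=> x /setU1P[->|xP]; last exact: connect_induced_sub PS (Pc _ xP).
  apply: connect_trans (connect_induced_sub PS (Pc _ zP)) (connect1 _).
  rewrite /induced /= setU11 setU1r //= adj_sym.
  by case/and3P: yz.
- move=> a b /setU1P[->|aP] /setU1P[->|bP] //; last exact: Pi.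
    by move=> ab; have := Pf _ bP; rewrite -ab fE ltnn.
  by move=> ab; have := Pf _ aP; rewrite ab fE ltnn.
by move=> x /setU1P[->//|/Pf xf]; rewrite fE ltnW.
Qed.

(** The distances to v of two points within n of u differ by at most 2 n. *)
Lemma card_geodesic_ball U v (P : {set G}) n u :
  P \subset component U v -> {in P &, injective (fun x => gdist (induced U) x v)} ->
  #|[set x in P | within (induced U) n u x]| <= n.*2.+1.
Proof.
move=> /subsetP PC; pose f x := gdist (induced U) x v; move=> Pi.
pose h x : 'I_n.*2.+1 := inord (f x - (f u - n)).
rewrite -[X in _ <= X]card_ord -(card_in_imset (f := h)); first exact: max_card.
have bound x : x \in [set x in P | within (induced U) n u x] -> f u - n <= f x <= f u + n.
  rewrite inE => /andP[/PC]; rewrite inE induced_connect_sym => xv ux.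
  have uv := connect_trans (within_connect ux) xv.
  have xu := within_sym (induced_sym U) ux.
  have := within_trans ux (gdist_within xv); rewrite within_gdist // -/(f x) -/(f u).
  have := within_trans xu (gdist_within uv); rewrite within_gdist // -/(f x) -/(f u).
  lia.
move=> x y xD yD /(congr1 val); have bx := bound x xD; have by_ := bound y yD.
move: xD yD; rewrite !inE => /andP[xP _] /andP[yP _].
rewrite /= !inordK; [|lia|lia] => E; apply: Pi => //.
by change (f x = f y); lia.
Qed.

Definition piece l i : {set G} := [set x | l x == i].
Definition upper l i : {set G} := [set x | i <= l x].
(** If the piece i is connected, this is the component that contained it when
    only the pieces before i had been removed. *)
Definition region l i : {set G} :=
  [set y | [exists x in piece l i, connect (induced (upper l i)) x y]].
Definition bag l i a : bool :=
  (a < i) && [exists x in piece l a, exists y in region l i, adj x y].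

(** The invariant of a piece.  It depends only on the pieces up to i and on the
    set of vertices of rank at least i, so that it survives any later refinement
    of the ranks ([good_ext]). *)
Record good k l i : Prop := Good {
  good_conn : connected_set (piece l i);
  good_bag : forall M, #|[set a : 'I_M | bag l i a]| <= k;
  good_touch : forall a, bag l i a -> touch (piece l a) (piece l i);
  good_ball : forall n u,
    #|[set x in piece l i | within (induced (upper l i)) n u x]| <= k.+1 * n.*2.+1 }.

Lemma regionP l i y : reflect
  (exists2 x, l x = i & connect (induced (upper l i)) x y) (y \in region l i).
Proof.
rewrite inE; apply: (iffP existsP) => [[x /andP[]]|[x xi xy]].
  by rewrite inE => /eqP; exists x.
by exists x; rewrite inE xi eqxx.
Qed.

Lemma bagP l i a : reflect
  (a < i /\ exists x y, [/\ l x = a, y \in region l i & adj x y]) (bag l i a).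
Proof.
apply: (iffP andP) => -[ai].
  case/existsP=> x /andP[]; rewrite inE => /eqP xa /existsP[y /andP[yC xy]].
  by split=> //; exists x, y.
case=> x [y [xa yC xy]]; split=> //; apply/existsP; exists x; rewrite inE xa eqxx.
by apply/existsP; exists y; rewrite yC.
Qed.

Lemma piece_region l x : x \in region l (l x).
Proof. by apply/regionP; exists x. Qed.

Lemma region_upper l i y : y \in region l i -> i <= l y.
Proof.
case/regionP=> x xi /connect_induced_mem; rewrite !inE xi => -> //.
Qed.

Lemma region_step l i x y : x \in region l i -> adj x y -> i <= l y -> y \in region l i.
Proof.
move=> xC xy iy; have ix := region_upper xC.
case/regionP: xC => z zi zx; apply/regionP; exists z => //.
by apply: connect_trans zx (connect1 _); rewrite /induced /= !inE ix iy.
Qed.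

Lemma region_component l i v : connected_set (piece l i) -> l v = i ->
  region l i = component (upper l i) v.
Proof.
move=> [_ pc] vi; apply/setP=> y; rewrite [RHS]inE; apply/regionP/idP => [[x xi xy]|vy]; last by exists v.
apply: connect_trans xy; apply: (@connect_induced_sub _ (piece l i)).
  by apply/subsetP=> z; rewrite !inE => /eqP->.
by apply: pc; rewrite inE ?vi ?xi.
Qed.

Lemma region_connected l i : connected_set (piece l i) -> connected_set (region l i).
Proof.
move=> pc; case: (pc) => /set0Pn[v]; rewrite inE => /eqP vi _.
by rewrite (region_component pc vi); apply: component_connected; rewrite inE vi.
Qed.

(** A connected set above b that touches the piece b lies in the region of b. *)
Lemma touch_bag l C a b : connected_set C -> C \subset upper l b -> a < b ->
  touch (piece l a) C -> touch (piece l b) C -> bag l b a.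
Proof.
move=> [_ Cc] CU ab [x [y [xa yC xy]]] [x' [y' [x'b y'C x'y']]].
rewrite inE in xa; rewrite inE in x'b.
apply/bagP; split=> //; exists x, y; split=> //; first exact/eqP.
apply/regionP; exists x'; first exact/eqP.
have /(_ y' y) := Cc; move=> /(_ y'C yC)/(connect_induced_sub CU).
apply: connect_trans; apply: connect1; rewrite /induced /= x'y' andbT.
by rewrite (subsetP CU _ y'C) inE (eqP x'b) leqnn.
Qed.

Lemma bag_touch l i a : bag l i a -> touch (piece l a) (region l i).
Proof.
by case/bagP=> _ [x [y [xa yC xy]]]; exists x, y; rewrite inE xa.
Qed.

(** This is the clique property that [card_reach] asks for. *)
Lemma bag_clique l i a b : connected_set (piece l i) ->
  bag l i a -> bag l i b -> a < b -> bag l b a.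
Proof.
move=> pc ia ib ab; apply: (touch_bag (region_connected pc)) => //; try exact: bag_touch.
case/bagP: ib => bi _; apply/subsetP=> y /region_upper iy; rewrite inE.
exact: leq_trans (ltnW bi) iy.
Qed.

Lemma good_ext k l l' i : (forall j, j <= i -> piece l j = piece l' j) ->
  upper l i = upper l' i -> good k l i -> good k l' i.
Proof.
move=> Ep Eu [gc gb gt gB].
have Ec : region l i = region l' i.
  by apply/setP=> y; rewrite !inE Ep // Eu.
have Eb a : bag l i a = bag l' i a.
  rewrite /bag; case: ltnP => //= /ltnW ai; rewrite -Ec -Ep //.
split; rewrite -?Eu -?Ep //.
  by move=> M; apply: leq_trans (gb M); apply/subset_leq_card/subsetP=> a; rewrite !inE Eb.
move=> a; rewrite -Eb => ba; rewrite -Ep; first exact: gt.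
by case/bagP: ba => /ltnW.
Qed.

(** The pieces touched by C touch each other: of two of them, the earlier is in
    the bag of the later by [touch_bag], hence touches it.  Together with C they
    form a complete minor. *)
Lemma card_touching k l n C : Kt_minor_free k.+2 G ->
  (forall i, i < n -> good k l i) -> connected_set C -> C \subset upper l n ->
  forall S : {set 'I_n}, (forall a, a \in S -> touch (piece l a) C) -> #|S| <= k.
Proof.
move=> free gl Cc CU S tS; rewrite leqNgt; apply/negP=> lt; apply: free.
pose B o := if o is Some a then piece l (a : 'I_n) else C.
have dC (a : 'I_n) : [disjoint piece l a & C].
  apply/pred0P=> x /=; rewrite inE; apply/negbTE/negP=> /andP[/eqP xa /(subsetP CU)].
  by rewrite inE xa leqNgt ltn_ord.
have tab (a b : 'I_n) : a \in S -> b \in S -> a < b -> touch (piece l a) (piece l b).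
  move=> aS bS ab; apply: (good_touch (gl _ (ltn_ord b))).
  apply: (touch_bag Cc _ ab); [|exact: tS|exact: tS].
  apply: subset_trans CU _; apply/subsetP=> x; rewrite !inE.
  by apply: leq_trans; apply: ltnW.
apply: (@complete_minor _ _ (None |: Some @: S) B).
- by rewrite cardsU1 card_imset; [rewrite (introF imsetP) //; case | apply: Some_inj].
- move=> [a|] //=; move=> _; exact: good_conn (gl _ (ltn_ord a)).
have memS a : Some a \in None |: Some @: S -> a \in S.
  by rewrite !inE /= (mem_imset _ _ Some_inj).
move=> [a|] [b|] //=.
- move=> /memS aS /memS bS ab; split.
    apply/pred0P=> x /=; rewrite !inE; apply/negbTE/negP=> /andP[/eqP-> /eqP/val_inj E].
    by rewrite E eqxx in ab.
  case: (ltngtP a b) => [lab|lba|/val_inj E]; first exact: tab.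
    exact/touch_sym/tab.
  by rewrite E eqxx in ab.
- by move=> /memS aS _ _; split; [apply: dC | apply: tS].
by move=> _ /memS bS _; split; [rewrite disjoint_sym; apply: dC | apply/touch_sym/tS].
Qed.

(** Vertices of rank n are those not yet placed.  The new piece keeps rank n and
    the other unplaced vertices move to rank n + 1. *)
Lemma decomposition_step k l n v : Kt_minor_free k.+2 G ->
  (forall x, l x <= n) -> (forall i, i < n -> good k l i) -> l v = n ->
  exists l', [/\ forall x, l' x <= n.+1, forall i, i < n.+1 -> good k l' i &
    #|piece l' n.+1| < #|piece l n|].
Proof.
move=> free ln gl vn; set U := upper l n; set C := component U v.
have vU : v \in U by rewrite inE vn.
have CU : C \subset U by apply: component_sub.
have Cc : connected_set C by apply: component_connected.
pose S := [set a : 'I_n | [exists x in piece l a, exists y in C, adj x y]].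
have tS a : a \in S -> exists x y, [/\ x \in piece l a, y \in C & adj x y].
  rewrite inE => /existsP[x /andP[xa /existsP[y /andP[yC xy]]]].
  by exists x, y.
have Sk : #|S| <= k.
  by apply: (card_touching free gl Cc CU) => a /tS.
have [P Pspec] : exists P : 'I_n -> {set G}, forall a, a \in S ->
    [/\ touch (piece l a) (P a), v \in P a, P a \subset C,
      forall x, x \in P a -> connect (induced (P a)) v x &
      {in P a &, injective (fun x => gdist (induced U) x v)}].
  apply: (@fin_all_exists _ (fun=> {set G}) (fun a Pa => a \in S ->
    [/\ touch (piece l a) Pa, v \in Pa, Pa \subset C,
      forall x, x \in Pa -> connect (induced Pa) v x &
      {in Pa &, injective (fun x => gdist (induced U) x v)}])) => a.
  have [aS|_] := boolP (a \in S); last by exists set0.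
  have [x [y [xa yC xy]]] := tS a aS.
  have [Pa [[vP yP] PC Pc Pi]] := geodesic vU yC.
  by exists Pa => _; split=> //; exists x, y.
(* With no touched piece the union is empty; v keeps the new piece nonempty. *)
pose H := v |: \bigcup_(a in S) P a.
have HC : H \subset C.
  rewrite subUset sub1set inE connect0 /=; apply/bigcupsP=> a aS.
  by case: (Pspec a aS).
have PH a : a \in S -> P a \subset H.
  by move=> aS; apply: subset_trans (subsetUr _ _); apply: bigcup_sup.
have Hc x : x \in H -> connect (induced H) v x.
  case/setU1P=> [->|/bigcupP[a aS xa]]; first exact: connect0.
  apply: (connect_induced_sub (PH a aS)).
  by case: (Pspec a aS) => _ _ _ /(_ x xa).
have HN x : x \in H -> l x = n.
  by move=> /(subsetP HC)/(subsetP CU); rewrite inE => xn; apply/anti_leq; rewrite ln.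
pose l' x := if (l x == n) && (x \notin H) then n.+1 else l x.
have pieceE j : j < n -> piece l j = piece l' j.
  move=> jn; apply/setP=> x; rewrite !inE /l'.
  case: ifP => // /andP[/eqP-> _]; lia.
have upperE j : j <= n -> upper l j = upper l' j.
  move=> jn; apply/setP=> x; rewrite !inE /l'.
  case: ifP => // /andP[/eqP-> _]; lia.
have pieceH : piece l' n = H.
  apply/setP=> x; rewrite inE /l'; case: (boolP (x \in H)) => xH /=.
    by rewrite andbF HN // eqxx.
  rewrite andbT; case: ifP => // /eqP _; lia.
have regionE : region l' n = C.
  rewrite (@region_component _ _ v); first by rewrite -upperE.
    by rewrite pieceH; apply: (connected_center _ Hc); rewrite setU11.
  by have : v \in piece l' n; [rewrite pieceH setU11 | rewrite inE => /eqP].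
have bagE a : bag l' n a -> exists2 a' : 'I_n, a = a' & a' \in S.
  case/bagP=> an [x [y [xa]]]; rewrite regionE => yC xy.
  exists (Ordinal an) => //; rewrite inE; apply/existsP; exists x.
  have -> : x \in piece l (Ordinal an) by rewrite pieceE // inE xa.
  by apply/existsP; exists y; rewrite yC.
exists l'; split.
- move=> x; rewrite /l'; case: ifP => _ //; exact: leq_trans (ln x) (leqnSn n).
- move=> i; rewrite ltnS leq_eqVlt => /orP[/eqP->|ltin]; last first.
    apply: good_ext (gl i ltin) => [j ji|]; first by rewrite pieceE // (leq_ltn_trans ji).
    exact/upperE/ltnW.
  split; rewrite ?pieceH.
  + by apply: (connected_center _ Hc); rewrite setU11.
  + move=> M; apply: leq_trans Sk.
    pose g (a : 'I_M) : option 'I_n := insub (a : nat).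
    have gE (a : 'I_M) (a' : 'I_n) : a = a' :> nat -> g a = Some a'.
      by rewrite /g => ->; rewrite valK.
    rewrite -(card_imset S Some_inj) -(card_in_imset (f := g)).
      apply/subset_leq_card/subsetP=> o /imsetP[a]; rewrite inE => /bagE[a' E a'S] ->.
      by rewrite (gE _ _ E) imset_f.
    move=> a b; rewrite !inE => /bagE[a' Ea _] /bagE[b' Eb _].
    by rewrite (gE _ _ Ea) (gE _ _ Eb) => -[E]; apply/val_inj; rewrite /= Ea Eb E.
  + move=> _ /bagE[a -> aS]; rewrite -pieceE //.
    case: (Pspec a aS) => -[x [y [xa ya xy]]] _ _ _ _.
    by exists x, y; split=> //; apply: subsetP ya; apply: PH.
  move=> m u; rewrite -upperE // -/U.
  have sub : [set x in H | within (induced U) m u x] \subset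
      v |: \bigcup_(a in S) [set x in P a | within (induced U) m u x].
    apply/subsetP=> x; rewrite inE => /andP[/setU1P[->|/bigcupP[a aS xa]] ux].
      exact: setU11.
    by apply/setU1r/bigcupP; exists a; rewrite // inE xa.
  apply: leq_trans (subset_leq_card sub) _.
  rewrite cardsU1 mulSn; apply: leq_add; first by case: (_ \notin _).
  apply: leq_trans (card_bigcup (c := m.*2.+1) _) _ => [a aS|].
    by case: (Pspec a aS) => _ _ PC _ Pi; apply: card_geodesic_ball PC Pi.
  by rewrite leq_mul2r Sk orbT.
apply: proper_card; apply/properP; split.
  apply/subsetP=> x; rewrite !inE /l'; case: ifP => [/andP[]//|_ /eqP xn].
  by have := ln x; rewrite xn ltnn.
by exists v; rewrite !inE ?vn // /l' setU11 andbF vn; lia.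
Qed.

Lemma decomposition k : Kt_minor_free k.+2 G ->
  exists l n, (forall x, l x < n) /\ (forall i, i < n -> good k l i).
Proof.
move=> free.
suff H l n : (forall x, l x <= n) -> (forall i, i < n -> good k l i) ->
    exists l n, (forall x, l x < n) /\ (forall i, i < n -> good k l i).
  by apply: (H (fun=> 0) 0).
have [m] := ubnP #|piece l n|; elim: m l n => // m IH l n lt ln gl.
have [p0|[v]] := set_0Vmem (piece l n).
  exists l, n; split=> // x; rewrite ltn_neqAle ln andbT.
  by move/setP: p0 => /(_ x); rewrite !inE => ->.
rewrite inE => /eqP vn.
have [l' [l'n gl' lt']] := decomposition_step free ln gl vn.
by apply: (IH l' n.+1) => //; apply: leq_trans lt' _.
Qed.

End Decomposition.

(** * Weak reachability *)

Section WeakReach.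
Variables (G : sgraph) (l : G -> nat).
Implicit Types (u v x y z a : G).

(** All vertices of one piece have the same rank, so this is weak reachability
    for an order with ties. *)
Definition wreach n u : {set G} := [set x | within (induced (upper l (l x))) n u x].

Lemma upper_sub i j : i <= j -> upper l j \subset upper l i.
Proof. by move=> ij; apply/subsetP=> x; rewrite !inE; apply: leq_trans. Qed.

Lemma wreach_level n u x : x \in wreach n u -> l x <= l u.
Proof.
rewrite inE; case: n => [|n]; first by rewrite within0 => /eqP->.
by case/withinSE=> [->//|[z /and3P[]]]; rewrite inE.
Qed.

(** Go from v to u and on to x; all ranks on the way are at least [l x]. *)
Lemma wreach_common m n u v x : v \in wreach m u -> x \in wreach n u -> l x <= l v ->
  x \in wreach (m + n) v.
Proof.
rewrite !inE => uv ux xv; apply: within_trans ux.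
apply: within_sym (induced_sym _) _.
exact: within_subrel (induced_sub (upper_sub xv)) uv.
Qed.

(** Split the walk at a vertex of least rank. *)
Lemma within_wreach n u a : within (@adj G) n u a ->
  exists x m1 m2, [/\ m1 + m2 = n, within (induced (upper l (l x))) m1 u x,
    within (induced (upper l (l x))) m2 x a, l x <= l u & l x <= l a].
Proof.
elim: n u => [|n IH] u.
  by rewrite within0 => /eqP->; exists a, 0, 0; split; rewrite ?within_refl.
case/withinSE=> [->|[z uz za]].
  by exists a, 0, n.+1; split; rewrite ?within_refl.
have [x [m1 [m2 [E zx xa xz la]]]] := IH z za.
have [xu|ux] := leqP (l x) (l u).
  exists x, m1.+1, m2; split=> //; first by rewrite addSn E.
  by apply: withinS zx; rewrite /induced /= !inE xu xz uz.
have sub := induced_sub (upper_sub (ltnW ux)).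
exists u, 0, n.+1; split=> //; first exact: within_refl; last exact: leq_trans (ltnW ux) la.
apply: (@withinS _ _ _ _ z).
  by rewrite /induced /= !inE leqnn uz (leq_trans (ltnW ux) xz).
by rewrite -E; apply: within_trans (within_subrel sub zx) (within_subrel sub xa).
Qed.

(** A walk that leaves the region of b for the first time enters a piece in the
    bag of b, and goes on in the region of that piece.  Each such move uses at
    least one step of the walk. *)
Lemma within_bag N (b i : 'I_N) n y x : (forall x, l x < N) -> l x = i ->
  i <= b -> y \in region l b -> within (induced (upper l i)) n y x ->
  within [rel b a : 'I_N | bag l b a] n b i.
Proof.
move=> lN xi.
have stay m (c : 'I_N) : i <= c -> x \in region l c ->
    within [rel b a : 'I_N | bag l b a] m c i.
  move=> ic /region_upper; rewrite xi => ci.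
  by have -> : c = i; [apply/val_inj/anti_leq; rewrite /= ci | apply: within_refl].
elim: n b y => [|n IH] b y ib yC yx.
  by move: yx; rewrite within0 => /eqP yx; apply: stay; rewrite // -yx.
case: (withinSE yx) => [yx'|[z /and3P[_ zi yz] zx]]; first by apply: stay; rewrite // -yx'.
rewrite inE in zi; have [bz|zb] := leqP b (l z).
  by apply: within_mono (IH b z ib (region_step yC yz bz) zx).
apply: (@withinS _ _ _ _ (Ordinal (lN z))); last exact: (IH (Ordinal (lN z)) z zi (piece_region l z) zx).
by apply/bagP; split=> //; exists z, y; rewrite adj_sym.
Qed.

Lemma card_wreach k N n u : (forall x, l x < N) -> (forall i, i < N -> good k l i) ->
  #|wreach n u| <= n.+1 ^ k * (k.+1 * n.*2.+1).
Proof.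
move=> lN gl; pose e := [rel b a : 'I_N | bag l b a].
pose R := [set j | within e n (Ordinal (lN u)) j].
have cR : #|R| <= n.+1 ^ k.
  apply: card_reach => [j a /bagP[]//|j a b|j].
    by apply: bag_clique; apply: good_conn (gl _ (ltn_ord j)).
  exact: good_bag (gl _ (ltn_ord j)) N.
have sub : wreach n u \subset
    \bigcup_(j in R) [set x in piece l j | within (induced (upper l j)) n u x].
  apply/subsetP=> x xW; move: (xW); rewrite inE => ux.
  apply/bigcupP; exists (Ordinal (lN x)); last by rewrite !inE eqxx.
  rewrite inE; apply: (within_bag (y := u) (x := x)) => //.
    exact: wreach_level xW.
  exact: piece_region.
apply: leq_trans (subset_leq_card sub) _.
apply: leq_trans (card_bigcup (c := k.+1 * n.*2.+1) _) _ => [j _|].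
  exact: good_ball (gl _ (ltn_ord j)) n u.
by rewrite leq_mul2r cR orbT.
Qed.

End WeakReach.

(** * Counting profiles *)

Section ProfileCount.
Variable G : sgraph.
Implicit Types (u v x a : G) (A : {set G}).

(** The link with the distance: [dist] is defined by shortest simple paths, and a
    shortest walk is simple. *)
Lemma within_dist n u v :
  within (@adj G) n u v = if dist u v is Some d then d <= n else false.
Proof.
rewrite /dist.
(* The index of [reflect] must vary while the proposition stays fixed. *)
have gen b (uvP : reflect (connect (@adj G) u v) b) :
    within (@adj G) n u v = if (match uvP with
      | ReflectT uv => Some (ex_minn (connect_has_path uv))
      | ReflectF _ => None end) is Some d then d <= n else false; last exact: gen.
case: uvP => uv; last by apply/negbTE/negP=> /within_connect.
case: ex_minnP => m /existsP[p /and3P[pp _ /eqP pv]] mmin; apply/idP/idP => [|mn]; last first.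
  apply: within_mono mn _; rewrite -pv; have := within_path pp; rewrite size_tuple //.
move=> /within_uniq_path[q uq qn]; apply: leq_trans qn; apply: mmin.
by apply/existsP; exists (in_tuple q).
Qed.

Lemma eq_profile A r u u' :
  (forall a (i : 'I_r.+1), a \in A -> within (@adj G) i u a = within (@adj G) i u' a) ->
  profile A r u = profile A r u'.
Proof.
move=> E; apply/ffunP=> -[a aA]; rewrite !ffunE /=.
have {}E i : i < r.+1 -> within (@adj G) i u a = within (@adj G) i u' a.
  by move=> ir; apply: (E a (Ordinal ir) aA).
move: E; case Du: (dist u a) => [d|]; case Du': (dist u' a) => [d'|] //= E.
- have [dr|rd] := ltnP d r.+1.
    have := E d dr; rewrite !within_dist Du Du' leqnn => /esym d'd.
    have := E d' (leq_ltn_trans d'd dr); rewrite !within_dist Du Du' leqnn => dd'.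
    by congr insub; apply/anti_leq; rewrite dd'.
  rewrite !insubF //; apply/negbTE; rewrite -leqNgt //.
  by rewrite ltnNge; have := E r (leqnn _); rewrite !within_dist Du Du' => <-; rewrite -ltnNge.
- rewrite insubF //; have := E r (leqnn _); rewrite !within_dist Du Du'.
  by rewrite ltnS.
rewrite insubF //; have := E r (leqnn _); rewrite !within_dist Du Du'.
by rewrite ltnS.
Qed.

(** The profiles are grouped by the vertex v of largest rank in
    [wreach l r u :&: A'].  Within the group of v the profile is determined by the
    trace on [wreach l (r + r) v], since a walk from u to a of length at most r can
    be split at a vertex of that set. *)
Lemma card_profiles k A r : Kt_minor_free k.+2 G -> A != set0 ->
  #|profiles A r| <= #|A| * (r.+1 ^ k * (k.+1 * r.*2.+1)) *
    ((r + r).+1 ^ k * (k.+1 * (r + r).*2.+1) * r.+1).+1 ^ k.+1.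
Proof.
move=> free A0; have [l [N [lN gl]]] := decomposition free.
pose A' := \bigcup_(a in A) wreach l r a.
pose D v := [set u | wreach l r u :&: A' \subset wreach l (r + r) v].
have cA' : #|A'| <= #|A| * (r.+1 ^ k * (k.+1 * r.*2.+1)).
  by apply: card_bigcup => a _; apply: card_wreach gl.
have cover : profiles A r \subset \bigcup_(v in A') (profile A r @: D v).
  apply/subsetP=> _ /imsetP[u _ ->].
  suff [v vA' uD] : exists2 v, v \in A' & u \in D v.
    by apply/bigcupP; exists v => //; apply: imset_f.
  (* If u reaches no vertex of A', any v in A' serves. *)
  have [X0|[x0 x0X]] := set_0Vmem (wreach l r u :&: A').
    have [a aA] := set0Pn _ A0; exists a; last by rewrite inE X0 sub0set.
    by apply/bigcupP; exists a; rewrite // inE within_refl.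
  have [v /setIP[vu vA'] vmax] := arg_maxnP l x0X.
  exists v => //; rewrite inE; apply/subsetP=> x xX.
  by apply: wreach_common vu _ (vmax _ xX); case/setIP: xX.
apply: leq_trans (subset_leq_card cover) _.
apply: leq_trans (card_bigcup (c := _) _) (leq_mul cA' (leqnn _)) => v _.
set X := wreach l (r + r) v.
apply: leq_trans (leq_imset_factor (g := trace X r) _) _; last first.
  apply: leq_trans (leq_trans _ (card_traces X r free)) _.
    by apply/subset_leq_card/subsetP=> _ /imsetP[u _ ->]; apply: imset_f.
  by rewrite leq_exp2r // ltnS leq_mul2r; apply/orP; right; apply: card_wreach gl.
suff half u u' : u \in D v -> trace X r u = trace X r u' ->
    forall a (i : 'I_r.+1), a \in A -> within (@adj G) i u a -> within (@adj G) i u' a.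
  move=> u u' uD u'D tr; apply: eq_profile => a i aA.
  by apply/idP/idP; apply: half.
rewrite inE => /subsetP uX tr a i aA.
case/(within_wreach l) => x [m1 [m2 [E ux xa _ _]]].
have le_ir : i <= r by rewrite -ltnS.
have m1r : m1 < r.+1 by lia.
have xX : x \in X.
  apply: uX; rewrite inE; apply/andP; split; first by rewrite inE; apply: within_mono ux; lia.
  apply/bigcupP; exists a => //; rewrite inE; apply: within_sym (induced_sym _) _.
  by apply: within_mono xa; lia.
have : (x, Ordinal m1r) \in trace X r u'.
  by rewrite -tr inE /= xX; apply: within_subrel ux; apply: induced_adj.
rewrite inE /= => /andP[_ u'x]; rewrite -E; apply: within_trans u'x _.
by apply: within_subrel xa; apply: induced_adj.
Qed.

End ProfileCount.

Lemma polynomial_bound k r :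
  (r.+1 ^ k * (k.+1 * r.*2.+1)) *
    ((r + r).+1 ^ k * (k.+1 * (r + r).*2.+1) * r.+1).+1 ^ k.+1 <=
  (2 * k.+1) * (2 ^ k * (4 * k.+1) + 1) ^ k.+1 * r.+1 ^ (k.+2 ^ 2 - 1).
Proof.
have -> : k.+2 ^ 2 - 1 = k.+1 + k.+2 * k.+1 by rewrite -mulnn; nia.
have le1 : r.+1 ^ k * (k.+1 * r.*2.+1) <= 2 * k.+1 * r.+1 ^ k.+1.
  have : r.*2.+1 <= 2 * r.+1 by lia.
  rewrite expnS; move: (_ ^ k) => p; nia.
have le2 : (r + r).+1 ^ k * (k.+1 * (r + r).*2.+1) * r.+1 < 
    (2 ^ k * (4 * k.+1) + 1) * r.+1 ^ k.+2.
  have : (r + r).+1 ^ k <= 2 ^ k * r.+1 ^ k.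
    by rewrite -expnMn; case: (k) => [|j]; rewrite ?expn0 // leq_exp2r //; lia.
  have : (r + r).*2.+1 <= 4 * r.+1 by lia.
  have : 0 < r.+1 ^ k by rewrite expn_gt0.
  rewrite !expnS; move: (r.+1 ^ k) (2 ^ k) ((r + r).+1 ^ k) => p q s p0 h1 h2.
  have h3 : s * (k.+1 * (r + r).*2.+1) <= q * p * (k.+1 * (4 * r.+1)).
    by apply: leq_mul h2 _; apply: leq_mul h1.
  have h4 := leq_mul h3 (leqnn r.+1).
  apply: leq_ltn_trans h4 _.
  have : 0 < r.+1 * (r.+1 * p) by rewrite !muln_gt0 p0.
  nia.
rewrite expnD mulnACA; apply: leq_mul le1 _.
by rewrite expnM -expnMn leq_exp2r.
Qed.

(** * The profile complexity of a class *)

(** That n is a bound at radius r for every graph of the class is a proposition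
    without a decision procedure; the least such n comes from the excluded
    middle. *)
Lemma profile_complexity_exists (C : graph_class) (g : nat -> nat) :
  bounds_profiles C g ->
  exists2 f, is_profile_complexity C f & forall r, f r <= g r.
Proof.
move=> Cg.
pose P r n := forall G : sgraph, C G -> forall A : {set G}, A != set0 ->
  #|profiles A r| <= n * #|A|.
pose b r n := if excluded_middle_informative (P r n) then true else false.
have bP r n : reflect (P r n) (b r n).
  by rewrite /b; case: excluded_middle_informative => H; constructor.
have Pg h : bounds_profiles C h -> forall r, b r (h r).
  by move=> Ch r; apply/bP => G CG A A0; apply: Ch.
have ex r : exists n, b r n by exists (g r); apply: Pg.
have fle h : bounds_profiles C h -> forall r, ex_minn (ex r) <= h r.
  by move=> Ch r; case: ex_minnP => m _; apply; apply: Pg.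
exists (fun r => ex_minn (ex r)); last exact: fle.
split; last exact: fle.
by move=> G CG A A0 r; case: ex_minnP => m /bP Pm _; apply: Pm.
Qed.

Lemma K1_minor_free_empty (G : sgraph) : Kt_minor_free 1 G -> forall x : G, False.
Proof.
move=> free x; apply: free.
apply: (@complete_minor G unit [set tt] (fun=> [set x]) 1).
- by rewrite cards1.
- move=> _ _; apply: (@connected_center _ _ x); rewrite ?set11 // => y /set1P->.
  exact: connect0.
by move=> [] [].
Qed.

Theorem theorem3 (t : nat) (ht : 1 <= t) :
  exists f : nat -> nat,
    is_profile_complexity (Kt_minor_free t) f /\
    exists C : nat, forall r : nat, 1 <= r -> f r <= C * r ^ (t ^ 2 - 1).
Proof.
suff [K bK] : exists K, bounds_profiles (Kt_minor_free t) (fun r => K * r.+1 ^ (t ^ 2 - 1)).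
  have [f fC fle] := profile_complexity_exists bK; exists f; split=> //.
  exists (K * 2 ^ (t ^ 2 - 1)) => r r1; apply: leq_trans (fle r) _.
  rewrite -mulnA leq_mul2l -expnMn; apply/orP; right.
  by case: (t ^ 2 - 1) => [|n]; rewrite ?expn0 // leq_exp2r //; lia.
case: t ht => [//|[_|k _]].
  exists 0 => G free A /set0Pn[x _].
  by case: (K1_minor_free_empty free x).
exists ((2 * k.+1) * (2 ^ k * (4 * k.+1) + 1) ^ k.+1) => G free A A0 r.
apply: leq_trans (card_profiles r free A0) _.
by rewrite -mulnA [X in _ <= X]mulnC leq_mul2l polynomial_bound orbT.
Qed.
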